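(* Let $R$ be a ring and let $A=\sigma(R)\langle x_1,\dots,x_n\rangle$ be a bijective skew PBW extension of $R$ with associated families $\Sigma,\Delta$. If $R$ is a right (resp. left) p.q.-Baer ring and $R$ is $(\Sigma,\Delta)$-compatible, then $A$ has Property $(a.c.)$ on the right (resp. left).
   Context: All rings are associative with identity. For $S\subseteq T$ (a ring $T$), $r_T(S)=\{a\in T: Sa=0\}$ and $\ell_T(S)=\{a\in T: aS=0\}$. A ring $A$ is a skew PBW extension of $R$, written $A=\sigma(R)\langle x_1,\dots,x_n\rangle$, if: (i) $R$ is a subring of $A$ with the same identity; (ii) there are elements $x_1,\dots,x_n\in A$ such that $A$ is a free left $R$-module with basis the standard monomials $x^\alpha=x_1^{\alpha_1}\cdots x_n^{\alpha_n}$, $\alpha\in\mathbb N^n$ (with $x^0=1$); (iii) for each $i$ and each nonzero $r\in R$ there is nonzero $c_{i,r}\in R$ with $x_ir-c_{i,r}x_i\in R$; (iv) for all $i,j$ there is nonzero $d_{i,j}\in R$ with $x_jx_i-d_{i,j}x_ix_j\in R+Rx_1+\cdots+Rx_n$. For such $A$ there are injective endomorphisms $\sigma_i$ of $R$ and $\sigma_i$-derivations $\delta_i$ of $R$ with $x_ir=\sigma_i(r)x_i+\delta_i(r)$ for all $r\in R$; $\Sigma=\{\sigma_1,\dots,\sigma_n\}$, $\Delta=\{\delta_1,\dots,\delta_n\}$. For $\alpha\in\mathbb N^n$, $\sigma^\alpha=\sigma_1^{\alpha_1}\circ\cdots\circ\sigma_n^{\alpha_n}$ and $\delta^\alpha=\delta_1^{\alpha_1}\circ\cdots\circ\delta_n^{\alpha_n}$.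 The extension is bijective if each $\sigma_i$ is bijective and each $d_{i,j}$ ($1\le i<j\le n$) is invertible. $R$ is $\Sigma$-compatible if for all $a,b\in R$ and $\alpha\in\mathbb N^n$: $a\sigma^\alpha(b)=0$ iff $ab=0$; $R$ is $\Delta$-compatible if for all $a,b\in R$ and $\beta\in\mathbb N^n$: $ab=0$ implies $a\delta^\beta(b)=0$; $(\Sigma,\Delta)$-compatible means both. $R$ is right p.q.-Baer if for every $a\in R$ there is an idempotent $e$ with $r_R(aR)=eR$; left p.q.-Baer if for every $a\in R$ there is an idempotent $e$ with $\ell_R(Ra)=Re$. A ring $T$ has Property $(a.c.)$ on the right if for every finitely generated right ideal $I$ of $T$ there is $c\in T$ with $r_T(I)=r_T(cT)$; on the left if for every finitely generated left ideal $I$ there is $c\in T$ with $\ell_T(I)=\ell_T(Tc)$. *)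

(* Defs.v *)
From HB Require Import structures.
From mathcomp Require Import all_boot all_order all_algebra.
Set Implicit Arguments. Unset Strict Implicit. Unset Printing Implicit Defensive.
Import GRing.Theory.
Local Open Scope ring_scope.

Definition mono (A : pzRingType) (n : nat) (x : 'I_n -> A) (al : 'I_n -> nat) : A :=
  \prod_(i < n) x i ^+ al i.

Definition sigma_pow (R : Type) (n : nat) (sigma : 'I_n -> R -> R)
  (al : 'I_n -> nat) : R -> R :=
  foldr (fun i g => iter (al i) (sigma i) \o g) id (enum 'I_n).

Definition delta_pow := sigma_pow.

Definition skew_PBW (R A : pzRingType) (f : {rmorphism R -> A}) (n : nat)
  (x : 'I_n -> A) : Prop :=
  [/\ injective f,
      (forall a : A, exists (s : seq {ffun 'I_n -> nat}) (c : {ffun 'I_n -> nat} -> R),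
          a = \sum_(al <- s) f (c al) * mono x al),
      (forall (s : seq {ffun 'I_n -> nat}) (c : {ffun 'I_n -> nat} -> R),
          uniq s -> \sum_(al <- s) f (c al) * mono x al = 0 ->
          forall al, al \in s -> c al = 0),
      (forall (i : 'I_n) (r : R), r != 0 ->
          exists c : R, c != 0 /\ exists r' : R, x i * f r - f c * x i = f r') &
      (forall i j : 'I_n, exists d : R, d != 0 /\
          exists (r0 : R) (rs : 'I_n -> R),
            x j * x i - f d * x i * x j = f r0 + \sum_(k < n) f (rs k) * x k)].

Definition bijective_skew_PBW (R A : pzRingType) (f : {rmorphism R -> A}) (n : nat)
  (x : 'I_n -> A) (sigma : 'I_n -> R -> R) : Prop :=
  [/\ skew_PBW f x,
      (forall i, bijective (sigma i)) &
      exists d : 'I_n -> 'I_n -> R,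
        (forall i j, d i j != 0 /\
          exists (r0 : R) (rs : 'I_n -> R),
            x j * x i - f (d i j) * x i * x j = f r0 + \sum_(k < n) f (rs k) * x k)
        /\ (forall i j : 'I_n, (i < j)%N -> exists u : R, u * d i j = 1 /\ d i j * u = 1)].

Definition assoc_families (R A : pzRingType) (f : {rmorphism R -> A}) (n : nat)
  (x : 'I_n -> A) (sigma delta : 'I_n -> R -> R) : Prop :=
  forall i r, x i * f r = f (sigma i r) * x i + f (delta i r).

Definition Sigma_compatible (R : pzRingType) (n : nat) (sigma : 'I_n -> R -> R) :=
  forall (a b : R) (al : 'I_n -> nat), a * sigma_pow sigma al b = 0 <-> a * b = 0.

Definition Delta_compatible (R : pzRingType) (n : nat) (delta : 'I_n -> R -> R) :=
  forall (a b : R) (be : 'I_n -> nat), a * b = 0 -> a * delta_pow delta be b = 0.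

Definition SD_compatible (R : pzRingType) (n : nat) (sigma delta : 'I_n -> R -> R) :=
  Sigma_compatible sigma /\ Delta_compatible delta.

Definition right_pq_Baer (R : pzRingType) : Prop :=
  forall a : R, exists e : R, e * e = e /\
    forall b : R, (forall r, (a * r) * b = 0) <-> (exists s, b = e * s).

Definition left_pq_Baer (R : pzRingType) : Prop :=
  forall a : R, exists e : R, e * e = e /\
    forall b : R, (forall r, b * (r * a) = 0) <-> (exists s, b = s * e).

Definition fg_right_ideal (T : pzRingType) (k : nat) (g : 'I_k -> T) (y : T) : Prop :=
  exists t : 'I_k -> T, y = \sum_(j < k) g j * t j.

Definition fg_left_ideal (T : pzRingType) (k : nat) (g : 'I_k -> T) (y : T) : Prop :=
  exists t : 'I_k -> T, y = \sum_(j < k) t j * g j.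

Definition ac_right (T : pzRingType) : Prop :=
  forall (k : nat) (g : 'I_k -> T), exists c : T, forall b : T,
    (forall y, fg_right_ideal g y -> y * b = 0) <-> (forall t, (c * t) * b = 0).

Definition ac_left (T : pzRingType) : Prop :=
  forall (k : nat) (g : 'I_k -> T), exists c : T, forall b : T,
    (forall y, fg_left_ideal g y -> b * y = 0) <-> (forall t, b * (t * c) = 0).

(* Main.v *)
Require Import Defs.
From HB Require Import structures.
From mathcomp Require Import all_boot all_order all_algebra.

(** If [e] is an idempotent generating the common right annihilator of the right
    ideals [a R], [a] ranging over the coefficients of the generators [g j], then the
    witness is [1 - e].  Compatibility makes every idempotent of [R] commute with
    the variables, so [e] stays left semicentral in [A], and [r_A((1 - e) A) = e A].
    What remains is that [g j A h = 0] forces [a R b = 0] for the coefficients [a] of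
    [g j] and [b] of [h].  Filter [A] by a weight on the variables for which every
    relation [x_j x_i - d x_i x_j] has strictly smaller weight than [x_i x_j], and
    which separates the finitely many monomials in play.  Leading terms then multiply,
    so the leading coefficient [a] of [g j] satisfies [a R b = 0] for the leading
    coefficient [b] of [h]; if [e_a R] is the annihilator of [a R], replacing [g j] by
    [g j e_a] removes this leading term while keeping track of the other
    coefficients.  The left-hand case is symmetric. *)
Set Implicit Arguments. Unset Strict Implicit. Unset Printing Implicit Defensive.
Import GRing.Theory.
Local Open Scope ring_scope.

(** * Exponent vectors and their weights *)

Section Exponents.
Variable n : nat.
Implicit Types al be : {ffun 'I_n -> nat}.

Definition exp0 : {ffun 'I_n -> nat} := [ffun=> 0%N].
Definition exp1 (i : 'I_n) : {ffun 'I_n -> nat} := [ffun k => (k == i) : nat].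
Definition expD al be : {ffun 'I_n -> nat} := [ffun k => (al k + be k)%N].

Lemma expDC al be : expD al be = expD be al.
Proof. by apply/ffunP=> k; rewrite !ffunE addnC. Qed.

Lemma expDA al be ga : expD al (expD be ga) = expD (expD al be) ga.
Proof. by apply/ffunP=> k; rewrite !ffunE addnA. Qed.

Lemma exp0D al : expD exp0 al = al.
Proof. by apply/ffunP=> k; rewrite !ffunE. Qed.

(** Peels off the lowest-index variable [j] that occurs, so that $x^{al}=x_jx^{ga}$ is already in
    standard order; the inductions on monomials run along this splitting. *)
Lemma exp_first_var al :
  al = exp0 \/
  exists (j : 'I_n) ga,
    al = expD (exp1 j) ga /\ forall k : 'I_n, (k < j)%N -> ga k = 0%N.
Proof.
case: (pickP (fun j => al j != 0%N)) => [j0 nz0|z]; last first.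
  by left; apply/ffunP=> k; rewrite ffunE; apply/eqP; rewrite -[_ == _]negbK z.
right; case: (@arg_minnP _ j0 (fun j => al j != 0%N) (@nat_of_ord n) nz0) => j nz minj.
exists j, [ffun k => (al k - (k == j))%N]; split.
  apply/ffunP=> k; rewrite !ffunE subnKC //.
  by case: eqP => // ->; rewrite lt0n.
move=> k ltkj; rewrite ffunE; case: (al k =P 0%N) => [->//|/eqP nzk].
by move: (minj k nzk); rewrite leqNgt ltkj.
Qed.

Variable w : 'I_n -> nat.
Definition weight al := (\sum_(k < n) al k * w k)%N.

Lemma weight0 : weight exp0 = 0%N.
Proof. by apply: big1 => k _; rewrite ffunE. Qed.

Lemma weight1 i : weight (exp1 i) = w i.
Proof.
rewrite /weight (bigD1 i) //= ffunE eqxx mul1n big1 ?addn0 // => k /negbTE ne.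
by rewrite ffunE ne.
Qed.

Lemma weightD al be : weight (expD al be) = (weight al + weight be)%N.
Proof. by rewrite -big_split; apply: eq_bigr => k _; rewrite ffunE mulnDl. Qed.

End Exponents.
Arguments exp0 {n}.

(** * Standard monomials *)

Section Monomials.
Variables (A : pzRingType) (n : nat) (x : 'I_n -> A).
Implicit Types al be : {ffun 'I_n -> nat}.

Lemma mono0 : mono x exp0 = 1.
Proof. by apply: big1 => i _; rewrite ffunE. Qed.

Lemma mono_mulvar (i : 'I_n) al :
  (forall k : 'I_n, (k < i)%N -> al k = 0%N) ->
  x i * mono x al = mono x (expD (exp1 i) al).
Proof.
move=> al0; rewrite /mono.
have: sorted (fun j k : 'I_n => (j < k)%N) (index_enum 'I_n).
  have := iota_ltn_sorted 0 n; rewrite -val_enum_ord sorted_map.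
  by rewrite enumT ![index_enum _]unlock.
have tr : transitive (fun j k : 'I_n => (j < k)%N) by move=> a b c; apply: ltn_trans.
rewrite sorted_pairwise //.
have : i \in index_enum 'I_n by rewrite mem_index_enum.
case/splitPr => r1 r2; rewrite pairwise_cat /= => /and4P[/allrelP lt1 _ lt2 _].
rewrite !big_cat !big_cons.
rewrite !(@big1_seq _ _ _ _ r1) ?Monoid.mul1m /= => [|k kr1|k kr1].
- rewrite ffunE ffunE eqxx add1n exprS mulrA; congr (_ * _).
  apply: eq_big_seq => k /(allP lt2) lt_ik; rewrite !ffunE.
  by case: eqP lt_ik => [->|//]; rewrite ltnn.
- have lt_ki := lt1 _ _ kr1 (mem_head _ _).
  by rewrite !ffunE al0 // addn0; case: eqP lt_ki => [->|//]; rewrite ltnn.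
- by rewrite al0 // (lt1 _ _ kr1) ?mem_head.
Qed.

Lemma mono1 i : mono x (exp1 i) = x i.
Proof.
have := @mono_mulvar i exp0; rewrite expDC exp0D => <- => [|k _]; last by rewrite ffunE.
by rewrite mono0 mulr1.
Qed.

End Monomials.

(** * Elements of bounded weight, and freeness on leading terms *)

Section Filtration.
Variables (R A : pzRingType) (f : {rmorphism R -> A}) (n : nat) (x : 'I_n -> A).
Variable w : 'I_n -> nat.
Implicit Types (a b : A) (al be : {ffun 'I_n -> nat}).
Local Notation X al := (mono x al).
Local Notation wt := (weight w).

(** Repeated exponents are allowed, so that sums are concatenations of lists. The bound is strict:
    for [d = 0] only the element 0 remains. *)
Definition low_weight d a :=
  exists2 s : seq (R * {ffun 'I_n -> nat}),
    a = \sum_(p <- s) f p.1 * X p.2 & all (fun p => wt p.2 < d)%N s.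

Lemma low0 d : low_weight d 0.
Proof. by exists [::]; rewrite ?big_nil. Qed.

Lemma low_mono d r al : (wt al < d)%N -> low_weight d (f r * X al).
Proof. by move=> lt; exists [:: (r, al)]; rewrite ?big_seq1 //= lt. Qed.

Lemma lowD d a b : low_weight d a -> low_weight d b -> low_weight d (a + b).
Proof.
by move=> [s -> ls] [t -> lt]; exists (s ++ t); rewrite ?big_cat // all_cat ls.
Qed.

Lemma low_sum d (I : Type) (s : seq I) (F : I -> A) :
  (forall i, low_weight d (F i)) -> low_weight d (\sum_(i <- s) F i).
Proof. by move=> lF; elim/big_ind: _ => //; [exact: low0 | exact: lowD]. Qed.

Lemma low_sum_seq d (I : eqType) (s : seq I) (F : I -> A) :
  (forall i, i \in s -> low_weight d (F i)) -> low_weight d (\sum_(i <- s) F i).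
Proof.
move=> lF; rewrite big_seq; elim/big_ind: _ => //; [exact: low0 | exact: lowD].
Qed.

Lemma low_scale d r a : low_weight d a -> low_weight d (f r * a).
Proof.
move=> [s -> ls]; exists [seq (r * p.1, p.2) | p <- s]; last by rewrite all_map.
by rewrite big_map mulr_sumr; apply: eq_bigr => p _; rewrite /= rmorphM mulrA.
Qed.

Lemma low_leq d e a : (d <= e)%N -> low_weight d a -> low_weight e a.
Proof.
move=> le [s -> ls]; exists s => //; apply: sub_all ls => p /leq_trans; exact.
Qed.

Lemma low_uniq d a : low_weight d a ->
  exists (s : seq {ffun 'I_n -> nat}) (c : {ffun 'I_n -> nat} -> R),
  [/\ uniq s, a = \sum_(al <- s) f (c al) * X al & all (fun al => wt al < d)%N s].
Proof.
move=> [s -> ls].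
exists (undup (map snd s)), (fun al => \sum_(p <- s | p.2 == al) p.1); split.
- exact: undup_uniq.
- under [RHS]eq_bigr => al _ do rewrite rmorph_sum mulr_suml.
  rewrite (exchange_big_dep xpredT) //=; apply: eq_big_seq => p ps.
  rewrite big_mkcond (bigD1_seq p.2) ?undup_uniq ?mem_undup ?map_f //= eqxx.
  by rewrite big1 ?addr0 // => al /negbTE; rewrite eq_sym => ->.
- by apply/allP=> al; rewrite mem_undup => /mapP[p /(allP ls) lt ->].
Qed.

Hypothesis free : forall (s : seq {ffun 'I_n -> nat}) (c : {ffun 'I_n -> nat} -> R),
  uniq s -> \sum_(al <- s) f (c al) * X al = 0 -> forall al, al \in s -> c al = 0.

(** Terms of smaller weight cannot involve [al], so prepending it keeps the exponents distinct and
    freeness applies. *)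
Lemma lead_eq0 r al a :
  low_weight (wt al) a -> f r * X al + a = 0 -> r = 0.
Proof.
move=> /low_uniq[s [c [us -> /allP lt]]] eq0.
have nals : al \notin s by apply/negP=> /lt; rewrite ltnn.
pose c' be := if be == al then r else c be.
have := @free (al :: s) c'; rewrite /= nals us => /(_ isT).
rewrite big_cons {1}/c' eqxx.
rewrite (eq_big_seq (fun be => f (c be) * X be)) => [|be bes]; last first.
  by rewrite /c'; case: eqP nals bes => // -> /negbTE ->.
by move=> /(_ eq0 al (mem_head _ _)); rewrite /c' eqxx.
Qed.

End Filtration.

(** * Straightening products and multiplying leading terms *)

Section Straightening.
Variables (R A : pzRingType) (f : {rmorphism R -> A}) (n : nat) (x : 'I_n -> A).
Variables (sigma delta : 'I_n -> R -> R) (w : 'I_n -> nat).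
Implicit Types (a b : A) (al be ga : {ffun 'I_n -> nat}).
Local Notation X al := (mono x al).
Local Notation wt := (weight w).
Local Notation low := (low_weight f x w).

(** What is kept of the invertibility of the $d_{i,j}$: it survives products and, through the
    annihilator hypothesis, application of [sigma]. *)
Definition right_cancellable (c : R) := forall y, y * c = 0 -> y = 0.

Hypothesis fam : assoc_families f x sigma delta.
Hypothesis sigma_ann : forall i (r s : R), r * sigma i s = 0 -> r * s = 0.
Hypothesis quad : forall i j : 'I_n, (j < i)%N ->
  exists d r0 rs, right_cancellable d /\
    x i * x j = f d * x j * x i + (f r0 + \sum_(k < n) f (rs k) * x k).
Hypothesis w_gt0 : forall i, (0 < w i)%N.
Hypothesis w_lt : forall i j k, (w k < w i + w j)%N.

Lemma var_scale i r a : x i * (f r * a) = f (sigma i r) * (x i * a) + f (delta i r) * a.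
Proof. by rewrite mulrA fam mulrDl mulrA. Qed.

(** Needs the bound only on monomials below weight [d], so it can serve inside the induction that
    proves this bound. *)
Lemma var_low_ind i d a :
  (forall al, wt al < d -> low (w i + d) (x i * X al))%N ->
  low d a -> low (w i + d)%N (x i * a).
Proof.
move=> lowX [s -> /allP ls]; rewrite mulr_sumr; apply: low_sum_seq => p /ls ltp.
rewrite var_scale; apply: lowD; first exact/low_scale/lowX.
by apply: low_mono; apply: leq_trans ltp (leq_addl _ _).
Qed.

(** Induction on the weight of the product. If [i] exceeds the first variable [j] of [al], the
    quadratic relation brings [x j] to the front; its linear terms contribute smaller weight because
    $w_k<w_i+w_j$. *)
Lemma var_mono_lead i al : exists c u,
  [/\ right_cancellable c, low (w i + wt al)%N u &
      x i * X al = f c * X (expD (exp1 i) al) + u].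
Proof.
have [d] := ubnP (w i + wt al); elim: d i al => // d IH i al; rewrite ltnS => led.
have ordered : (forall k : 'I_n, (k < i)%N -> al k = 0%N) -> exists c u,
    [/\ right_cancellable c, low (w i + wt al)%N u &
        x i * X al = f c * X (expD (exp1 i) al) + u].
  move=> al0; exists 1, 0; split; [by move=> y; rewrite mulr1 | exact: low0 |].
  by rewrite mono_mulvar // rmorph1 mul1r addr0.
have [al0|[j [ga [Dal ga0]]]] := exp_first_var al.
  by apply: ordered => k _; rewrite al0 ffunE.
have [leij|ltji] := leqP i j.
  apply: ordered => k ltki; have ltkj := leq_trans ltki leij.
  by rewrite Dal !ffunE ga0 // addn0; case: eqP ltkj => [->|//]; rewrite ltnn.
have [c0 [r0 [rs [reg0 Dij]]]] := quad ltji.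
have Dw : (w i + wt al = w j + (w i + wt ga))%N.
  by rewrite Dal weightD weight1 addnCA.
have IHlow k be : (w k + wt be < d)%N -> low (w k + wt be).+1 (x k * X be).
  move=> /IH[c [u [_ lowu ->]]]; apply: lowD; last exact: low_leq lowu.
  by apply: low_mono; rewrite weightD weight1.
have ltga : (w i + wt ga < w i + wt al)%N by rewrite Dw -[ltnLHS]add0n ltn_add2r.
have [c [u [regc lowu Dx]]] := IH i ga (leq_trans ltga led).
exists (c0 * sigma j c), (f c0 * (f (delta j c) * X (expD (exp1 i) ga) + x j * u) +
    (f r0 * X ga + \sum_(k < n) f (rs k) * (x k * X ga))); split.
- by move=> y; rewrite mulrA => /sigma_ann/regc/reg0.
- apply: lowD; last first.
    apply: lowD; first by apply: low_mono; apply: leq_ltn_trans ltga; apply: leq_addl.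
    apply: low_sum => k; apply: low_scale.
    have ltk : (w k + wt ga < w i + wt al)%N by rewrite Dw addnA ltn_add2r addnC w_lt.
    by apply: (low_leq ltk); apply: IHlow; apply: leq_trans led.
  apply/low_scale/lowD.
    by apply: low_mono; rewrite Dw weightD weight1 -[ltnLHS]add0n ltn_add2r.
  rewrite Dw; apply: var_low_ind lowu => be ltbe.
  have ltj : (w j + wt be < w i + wt al)%N by rewrite Dw ltn_add2l.
  by rewrite -Dw; apply: (low_leq ltj); apply: IHlow; apply: leq_trans led.
- have -> : X al = x j * X ga by rewrite mono_mulvar // Dal.
  rewrite mulrA Dij mulrDl -mulrA Dx mulrDl mulr_suml -mulrA mulrDr var_scale.
  rewrite mono_mulvar; last first.
    move=> k ltkj; rewrite !ffunE ga0 // addn0.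
    by case: eqP (ltn_trans ltkj ltji) => [->|//]; rewrite ltnn.
  have -> : expD (exp1 j) (expD (exp1 i) ga) = expD (exp1 i) al.
    by rewrite Dal !expDA [expD (exp1 j) _]expDC.
  under eq_bigr => k _ do rewrite -mulrA.
  by rewrite !mulrDr rmorphM !mulrA !addrA.
Qed.

Lemma var_low i d a : low d a -> low (w i + d)%N (x i * a).
Proof.
apply: var_low_ind => al ltd; have [c [u [_ lowu ->]]] := var_mono_lead i al.
apply: lowD; last by apply: low_leq lowu; rewrite leq_add2l ltnW.
by apply: low_mono; rewrite weightD weight1 ltn_add2l.
Qed.

(* Stated through left annihilators so that no multiplicativity of [sigma] is needed. *)
Lemma mono_scale_mono_lead al r be : exists t u,
  [/\ forall y, y * t = 0 -> y * r = 0, low (wt al + wt be)%N u &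
      X al * (f r * X be) = f t * X (expD al be) + u].
Proof.
have [d] := ubnP (wt al); elim: d al => // d IH al; rewrite ltnS => led.
have [->|[j [ga [Dal ga0]]]] := exp_first_var al.
  by exists r, 0; rewrite mono0 mul1r exp0D addr0; split=> //; apply: low0.
have Dw : wt al = (w j + wt ga)%N by rewrite Dal weightD weight1.
have [|t [u [tann lowu Dx]]] := IH ga.
  by apply: leq_trans led; rewrite Dw -[ltnLHS]add0n ltn_add2r.
(* [be] may contain variables before [j], so [x j] has to be straightened again, at the cost of the
   cancellable factor [c]. *)
have [c [v [regc lowv Dv]]] := var_mono_lead j (expD ga be).
rewrite weightD in lowv.
exists (sigma j t * c),
  (f (sigma j t) * v + (f (delta j t) * X (expD ga be) + x j * u)); split.
- by move=> y; rewrite mulrA => /regc/sigma_ann/tann.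
- rewrite Dw -addnA; apply: lowD; first exact: low_scale.
  apply: lowD; last exact: var_low.
  by apply: low_mono; rewrite weightD -[ltnLHS]add0n ltn_add2r.
- have -> : X al = x j * X ga by rewrite mono_mulvar // Dal.
  by rewrite -mulrA Dx mulrDr var_scale Dv mulrDr rmorphM Dal -expDA !mulrA !addrA.
Qed.

(** One strict bound is enough: weights below [d] and at most [e] add up to less than [d + e]. *)
Lemma mul_low d e a b r :
  low d a -> low e.+1 b -> low (d + e) (a * (f r * b)).
Proof.
move=> [s -> /allP ls] [t -> /allP lt]; rewrite mulr_suml; apply: low_sum_seq => p ps.
rewrite mulr_sumr mulr_sumr; apply: low_sum_seq => q qt.
rewrite -mulrA [f r * _]mulrA -rmorphM; apply: low_scale.
have [c [u [_ lowu ->]]] := mono_scale_mono_lead p.2 (r * q.1) q.2.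
have ltpq : (wt p.2 + wt q.2 < d + e)%N.
  by have := leq_add (ls p ps) (lt q qt); rewrite addSn !addnS ltnS.
apply: lowD; last by apply: low_leq lowu; apply: ltnW.
by apply: low_mono; rewrite weightD.
Qed.

Lemma low_mul d e a b r :
  low d.+1 a -> low e b -> low (d + e) (a * (f r * b)).
Proof.
case: e => [|e] la lb; last by rewrite addnS -addSn; apply: mul_low.
have -> : b = 0 by case: lb => [[|p s] ->]; rewrite ?big_nil.
by rewrite !mulr0; apply: low0.
Qed.

Hypothesis free : forall (s : seq {ffun 'I_n -> nat}) (c : {ffun 'I_n -> nat} -> R),
  uniq s -> \sum_(al <- s) f (c al) * X al = 0 -> forall al, al \in s -> c al = 0.

(** Every product other than that of the leading terms has smaller weight, so freeness gives
    [p * t = 0], with [t] the leading coefficient of $x^{al}rq\,x^{be}$; whatever kills [t] from the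
    left kills [r * q]. *)
Lemma lead_mul_eq0 (p q r : R) al be a b :
  low (wt al) a -> low (wt be) b ->
  (f p * X al + a) * (f r * (f q * X be + b)) = 0 -> p * r * q = 0.
Proof.
move=> la lb eq0.
have [t [u [tann lowu Dx]]] := mono_scale_mono_lead al (r * q) be.
have pt0 : p * t = 0.
  apply: (lead_eq0 (w := w) (al := expD al be) free
    (a := f p * u + (f p * X al * (f r * b) + a * (f r * (f q * X be + b))))).
    rewrite weightD; apply: lowD; first exact: low_scale.
    apply: lowD; first by apply: low_mul => //; apply: low_mono.
    apply: mul_low => //; apply: lowD; first exact: low_mono.
    exact: low_leq lb.
  rewrite -eq0 mulrDl !addrA; congr (_ + _).
  rewrite mulrDr mulrDr; congr (_ + _).
  by rewrite -mulrA [f r * _]mulrA -rmorphM Dx mulrDr mulrA rmorphM.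
by rewrite -mulrA; apply: tann.
Qed.

End Straightening.

(** * Weights that separate finitely many monomials *)

Section Weights.
Variables (n : nat).
Implicit Types al be : {ffun 'I_n -> nat}.

Lemma digits_lt N m (a : 'I_m -> nat) :
  (forall i, a i < N)%N -> (\sum_(i < m) a i * N ^ i < N ^ m)%N.
Proof.
elim: m a => [|m IH] a lt_a; first by rewrite big_ord0.
rewrite big_ord_recr /=; apply: (@leq_trans (N ^ m + a ord_max * N ^ m)).
  by rewrite -addSn leq_add2r; apply: (IH (fun i => a (widen_ord (leqnSn m) i))).
by rewrite -mulSn expnS leq_mul2r lt_a orbT.
Qed.

Lemma digits_inj N m (a b : 'I_m -> nat) :
  (forall i, a i < N)%N -> (forall i, b i < N)%N ->
  (\sum_(i < m) a i * N ^ i = \sum_(i < m) b i * N ^ i)%N -> a =1 b.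
Proof.
elim: m a b => [|m IH] a b lt_a lt_b; first by move=> _ [].
have N0 : (0 < N)%N by apply: leq_ltn_trans (lt_a ord0).
rewrite !big_ord_recl !expn0 !muln1.
have factor (c : 'I_m.+1 -> nat) : (\sum_(i < m) c (lift ord0 i) * N ^ lift ord0 i =
    (\sum_(i < m) c (lift ord0 i) * N ^ i) * N)%N.
  rewrite big_distrl; apply: eq_bigr => i _.
  by rewrite /= /bump expnS -mulnA [(_ ^ _ * N)%N]mulnC.
rewrite !factor => eq_ab.
have eq0 : a ord0 = b ord0.
  by rewrite -(modn_small (lt_a ord0)) -(modn_small (lt_b ord0)) -(modnMDl
    (\sum_(i < m) a (lift ord0 i) * N ^ i)) addnC eq_ab addnC modnMDl.
move: eq_ab; rewrite eq0 => /addnI/eqP; rewrite eqn_pmul2r // => /eqP eq_ab i.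
by case: (unliftP ord0 i) => [j ->|->] //; apply: (IH _ _ _ _ eq_ab).
Qed.

(* With [N] above all exponents in [S], the weights [N ^ n + N ^ i] encode
   degree-lexicographic comparison on [S]. *)
Lemma separating_weight (S : seq {ffun 'I_n -> nat}) : exists w : 'I_n -> nat,
  [/\ forall i, (0 < w i)%N, forall i j k, (w k < w i + w j)%N &
      {in S &, injective (weight w)}].
Proof.
pose N := (\sum_(al <- S) \sum_(i < n) al i).+1.
have ltN al i : al \in S -> (al i < N)%N.
  by move=> alS; rewrite ltnS (big_rem al) //= (bigD1 i) //= -addnA leq_addr.
pose M := (N ^ n)%N.
have Npos k : (0 < N ^ k)%N by rewrite expn_gt0.
exists (fun i => M + N ^ i)%N; split.
- by move=> i; rewrite addn_gt0 Npos orbT.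
- move=> i j k; rewrite -addnA ltn_add2l.
  apply: (@leq_ltn_trans M); first by rewrite leq_pexp2l // ltnW.
  by rewrite addnCA -[ltnLHS]addn0 ltn_add2l addn_gt0 Npos.
have Dw al : weight (fun i => M + N ^ i)%N al =
    ((\sum_(i < n) al i) * M + \sum_(i < n) al i * N ^ i)%N.
  by rewrite big_distrl -big_split; apply: eq_bigr => i _; rewrite mulnDr.
(* Modulo [M] the total degree disappears, and the base [N] expansion, which is below [M],
   remains. *)
move=> al be alS beS; rewrite !Dw => /(congr1 (modn^~ M)).
rewrite !modnMDl !modn_small ?digits_lt // => [eq_ab||]; try by move=> i; apply: ltN.
by apply/ffunP/(digits_inj _ _ eq_ab) => i; apply: ltN.
Qed.

End Weights.

(** * Common annihilators of finite sets in p.q.-Baer rings *)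

Section Baer.

(** Intersecting annihilators amounts to multiplying their idempotents; left semicentrality,
    $re=ere$, keeps the product idempotent and passes to it. *)
Lemma right_pq_Baer_ann (R : pzRingType) : right_pq_Baer R ->
  forall L : seq R, exists e : R,
  [/\ e * e = e, forall r, r * e = e * r * e, forall a, a \in L -> forall r, a * r * e = 0 &
      forall b, (forall a, a \in L -> forall r, a * r * b = 0) -> e * b = b].
Proof.
move=> pq; elim=> [|a L [e2 [e22 c2 a2 b2]]].
  by exists 1; split=> // [|r|b _]; rewrite ?(mul1r, mulr1).
have [e1 [e11 ann]] := pq a.
have a1 r : a * r * e1 = 0 by apply/ann: r; exists 1; rewrite mulr1.
have c1 r : r * e1 = e1 * r * e1.
  (* The right annihilator of [a R] is a two-sided ideal, so it contains [r * e1]. *)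
  have /ann[s Ds] : forall r', a * r' * (r * e1) = 0 by move=> r'; rewrite mulrA -(mulrA a).
  by rewrite -mulrA Ds mulrA e11.
exists (e1 * e2); split.
- by rewrite -mulrA [e2 * _]mulrA -c2 mulrA e11.
- move=> r; rewrite [LHS]mulrA [r * e1]c1.
  by rewrite -!mulrA [r * (e1 * e2)]mulrA [in LHS]c2 !mulrA.
- by move=> b; rewrite inE => /predU1P[->|/a2 bL] r; rewrite mulrA ?a1 ?mul0r // -(mulrA b) bL.
- move=> b annb; rewrite -mulrA b2 => [|a' a'L]; last by apply: annb; rewrite inE a'L orbT.
  by have /ann[s ->] := annb a (mem_head _ _); rewrite mulrA e11.
Qed.

(** The brackets are placed so that this is, by conversion, the right-hand statement in the opposite
    ring. *)
Lemma left_pq_Baer_ann (R : pzRingType) : left_pq_Baer R ->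
  forall L : seq R, exists e : R,
  [/\ e * e = e, forall r, e * r = e * (r * e), forall a, a \in L -> forall r, e * (r * a) = 0 &
      forall b, (forall a, a \in L -> forall r, b * (r * a) = 0) -> b * e = b].
Proof. exact: (@right_pq_Baer_ann R^c). Qed.

End Baer.

(** * Compatibility, idempotents and polynomials in the extension *)

Section Extension.
Variables (R A : pzRingType) (f : {rmorphism R -> A}) (n : nat) (x : 'I_n -> A).
Variables (sigma delta : 'I_n -> R -> R).
Implicit Types (al be : {ffun 'I_n -> nat}) (s : seq {ffun 'I_n -> nat}).
Implicit Types (c : {ffun 'I_n -> nat} -> R).
Local Notation X al := (mono x al).

Definition skew_poly s c : A := \sum_(al <- s) f (c al) * X al.

Hypothesis PBW : bijective_skew_PBW f x sigma.
Hypothesis fam : assoc_families f x sigma delta.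
Hypothesis compat : SD_compatible sigma delta.

Lemma pow_exp1 (phi : 'I_n -> R -> R) i : sigma_pow phi (exp1 i) =1 phi i.
Proof.
move=> r; rewrite /sigma_pow; have : i \in enum 'I_n by rewrite mem_enum.
have id_off (t : seq 'I_n) : i \notin t ->
    foldr (fun k g => iter (exp1 i k) (phi k) \o g) id t r = r.
  elim: t => //= k t IH; rewrite inE negb_or => /andP[ne /IH ->].
  by rewrite ffunE eq_sym (negbTE ne).
elim: (enum _) (enum_uniq 'I_n) => //= k t IH /andP[kt ut].
rewrite inE ffunE => /predU1P[Dk|it]; first by rewrite -Dk eqxx /= id_off ?Dk.
by rewrite IH //; case: eqP it kt => // -> ->.
Qed.

Lemma sigma_ann i (r s : R) : r * sigma i s = 0 -> r * s = 0.
Proof. by move=> rs0; apply/(compat.1 r s (exp1 i)); rewrite pow_exp1. Qed.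

Lemma ann_sigma i (r s : R) : r * s = 0 -> r * sigma i s = 0.
Proof. by move=> /(compat.1 r s (exp1 i)); rewrite pow_exp1. Qed.

Lemma ann_delta i (r s : R) : r * s = 0 -> r * delta i s = 0.
Proof. by move=> /(compat.2 r s (exp1 i)); rewrite /delta_pow pow_exp1. Qed.

Lemma PBW_free s c : uniq s -> skew_poly s c = 0 -> forall al, al \in s -> c al = 0.
Proof. by case: PBW => -[_ _ free _ _] _ _; apply: free. Qed.

Lemma PBW_gen (a : A) : exists s c, uniq s /\ a = skew_poly s c.
Proof.
have [[_ gen _ _ _] _ _] := PBW; have [s [c ->]] := gen a.
(* With all weights zero every monomial lies below 1, so equal exponents can be collected in any
   element. *)
have : low_weight f x (fun=> 0%N) 1 (\sum_(al <- s) f (c al) * X al).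
  apply: low_sum => al; apply: low_mono.
  by rewrite /weight big1 // => i _; rewrite muln0.
by case/low_uniq => t [c' [ut -> _]]; exists t, c'.
Qed.

Lemma PBW_quad (i j : 'I_n) : (j < i)%N -> exists d r0 rs, right_cancellable d /\
  x i * x j = f d * x j * x i + (f r0 + \sum_(k < n) f (rs k) * x k).
Proof.
have [_ _ [d [Hd inv]]] := PBW; move=> /inv[u [_ du]].
have [_ [r0 [rs Dij]]] := Hd j i; exists (d j i), r0, rs; split.
  by move=> y yd0; rewrite -[y]mulr1 -du mulrA yd0 mul0r.
by rewrite -Dij addrC subrK.
Qed.

Lemma var_coef_eq0 i (p q : R) : f p * x i + f q = 0 -> p = 0 /\ q = 0.
Proof.
have [[finj _ _ _ _] _ _] := PBW; move=> eq0.
have p0 : p = 0.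
  apply: (lead_eq0 (w := fun=> 1%N) (al := exp1 i) PBW_free (a := f q)).
    by rewrite -[f q]mulr1 -(mono0 x); apply: low_mono; rewrite weight0 weight1.
  by rewrite mono1.
by split=> //; apply: finj; rewrite rmorph0 -eq0 p0 rmorph0 mul0r add0r.
Qed.

(* Compatibility forces [sigma i e = e] and [delta i e = 0] for idempotent [e]. *)
Lemma var_idem_comm i (e : R) : e * e = e -> x i * f e = f e * x i.
Proof.
move=> ee.
(* Comparing coefficients in $x_i(1-e)+x_ie=x_i$ gives $\sigma_i(1-e)=1-\sigma_i(e)$ and
   $\delta_i(1-e)=-\delta_i(e)$. *)
have [|sC dC] := @var_coef_eq0 i (sigma i (1 - e) - (1 - sigma i e))
    (delta i (1 - e) + delta i e).
  have := fam i (1 - e); rewrite rmorphB rmorph1 mulrBr mulr1 fam => eqC.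
  have {}eqC : f (sigma i (1 - e)) * x i + f (delta i (1 - e)) +
     (f (sigma i e) * x i + f (delta i e)) = x i by rewrite -eqC subrK.
  rewrite rmorphB rmorphB rmorph1 rmorphD mulrBl mulrBl mul1r.
  by rewrite opprB addrACA [_ - _ + _]addrAC addrA eqC subrr.
have e1 : e * (1 - e) = 0 by rewrite mulrBr mulr1 ee subrr.
have e2 : (1 - e) * e = 0 by rewrite mulrBl mul1r ee subrr.
(* From $(1-e)e=0$ comes $\delta_i(e)=e\delta_i(e)$, and from $e(1-e)=0$ comes $e\delta_i(e)=0$. The
   same two products give $\sigma_i(e)=e\sigma_i(e)=e$. *)
have De : delta i e = 0.
  have /eqP := ann_delta i e2; rewrite mulrBl mul1r subr_eq0 => /eqP ->.
  have := ann_delta i e1; move/eqP: dC; rewrite addr_eq0 => /eqP ->.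
  by rewrite mulrN => /eqP; rewrite oppr_eq0 => /eqP.
have Se : sigma i e = e.
  have /eqP := ann_sigma i e2; rewrite mulrBl mul1r subr_eq0 => /eqP ->.
  have := ann_sigma i e1; move/eqP: sC; rewrite subr_eq0 => /eqP ->.
  by rewrite mulrBr mulr1 => /eqP; rewrite subr_eq0 => /eqP <-.
by rewrite fam De Se rmorph0 addr0.
Qed.

Lemma mono_idem_comm al (e : R) : e * e = e -> X al * f e = f e * X al.
Proof.
move=> ee; apply: commr_sym; apply: commr_prod => i _; apply: commrX.
exact/commr_sym/var_idem_comm.
Qed.

Lemma skew_poly_scalel s c (r : R) : f r * skew_poly s c = skew_poly s (fun al => r * c al).
Proof. by rewrite mulr_sumr; apply: eq_bigr => al _; rewrite rmorphM mulrA. Qed.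

Lemma skew_poly_scaler s c (e : R) : e * e = e ->
  skew_poly s c * f e = skew_poly s (fun al => c al * e).
Proof.
move=> ee; rewrite mulr_suml; apply: eq_bigr => al _.
by rewrite -mulrA mono_idem_comm // rmorphM mulrA.
Qed.

Lemma skew_poly_eq0 s c : (forall al, al \in s -> c al = 0) -> skew_poly s c = 0.
Proof. by move=> c0; rewrite /skew_poly big_seq big1 // => al /c0 ->; rewrite rmorph0 mul0r. Qed.

(** * Annihilation of coefficients by comparing leading terms *)

Section Weighted.
Variable w : 'I_n -> nat.
Hypothesis w_gt0 : forall i, (0 < w i)%N.
Hypothesis w_lt : forall i j k, (w k < w i + w j)%N.
Local Notation wt := (weight w).
Local Notation decreasing := (sorted (fun al be => (wt be < wt al)%N)).

Lemma PBW_lead_eq0 (p q r : R) al be a b :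
  low_weight f x w (wt al) a -> low_weight f x w (wt be) b ->
  (f p * X al + a) * (f r * (f q * X be + b)) = 0 -> p * r * q = 0.
Proof. exact: (lead_mul_eq0 fam sigma_ann PBW_quad w_gt0 w_lt PBW_free). Qed.

Lemma decreasing_tail_low al s c :
  decreasing (al :: s) -> low_weight f x w (wt al) (skew_poly s c).
Proof.
rewrite /= path_sortedE => [/andP[/allP lt _]|]; last by move=> a b d /[swap]; apply: ltn_trans.
by apply: low_sum_seq => be /lt; apply: low_mono.
Qed.

Lemma decreasing_perm s : uniq s -> {in s &, injective wt} ->
  exists2 t, perm_eq s t & decreasing t.
Proof.
move=> us winj; pose t := sort (fun al be => wt be <= wt al)%N s.
have pt : perm_eq s t by rewrite perm_sym perm_sort.
exists t => //; have := gtn_sorted_uniq_geq (map wt t).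
rewrite !sorted_map => ->; rewrite map_inj_in_uniq ?(perm_uniq pt) in us *.
  by rewrite us sort_sorted // => al be; apply: leq_total.
by move=> al be; rewrite -!(perm_mem pt); apply: winj.
Qed.

(** Leading terms give $c_{al}Rb=0$, so $b=eb$ with $eR=r_R(c_{al}R)$. Right multiplication of the
    polynomial by [e] kills its leading term and preserves the hypothesis; induction then treats the
    coefficients [c ga * e]. *)
Lemma right_coef_ann s c (b : R) be h : right_pq_Baer R ->
  decreasing s -> low_weight f x w (wt be) h ->
  (forall r, skew_poly s c * (f r * (f b * X be + h)) = 0) ->
  forall al, al \in s -> forall r, c al * r * b = 0.
Proof.
move=> pq + lh; elim: s c => // al s IH c dec ann0.
have lead0 r : c al * r * b = 0.
  apply: (PBW_lead_eq0 (decreasing_tail_low c dec) lh).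
  by have := ann0 r; rewrite /skew_poly big_cons.
have [e [ee cen annL]] := right_pq_Baer_ann pq [:: c al].
move=> /(_ b)eb.
have {}eb : e * b = b by apply: eb => a; rewrite inE => /eqP->.
move=> ga; rewrite inE => /predU1P[-> //|gas] r.
(* Semicentrality undoes the multiplication by [e]: $c_{ga}rb=c_{ga}reb=c_{ga}ereb=(c_{ga}e)rb$. *)
rewrite -eb mulrA -(mulrA (c ga)) cen !mulrA -[_ * e * b]mulrA eb.
apply: (IH (fun al => c al * e)) => //; first exact: path_sorted dec.
move=> r'; have -> : skew_poly s (fun al => c al * e) = skew_poly (al :: s) c * f e.
  rewrite skew_poly_scaler // /skew_poly big_cons.
  by rewrite -[c al]mulr1 annL ?mem_head // rmorph0 mul0r add0r.
by rewrite -mulrA [f e * _]mulrA -rmorphM ann0.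
Qed.

(** Mirror image of the right-hand case: [e] multiplies the polynomial from the left, so it crosses
    no monomial. *)
Lemma left_coef_ann s c (b : R) be h : left_pq_Baer R ->
  decreasing s -> low_weight f x w (wt be) h ->
  (forall r, (f b * X be + h) * (f r * skew_poly s c) = 0) ->
  forall al, al \in s -> forall r, b * (r * c al) = 0.
Proof.
move=> pq + lh; elim: s c => // al s IH c dec ann0.
have lead0 r : b * (r * c al) = 0.
  rewrite mulrA; apply: (PBW_lead_eq0 lh (decreasing_tail_low c dec)).
  by have := ann0 r; rewrite /skew_poly big_cons.
have [e [ee cen annL]] := left_pq_Baer_ann pq [:: c al].
move=> /(_ b)eb.
have {}eb : b * e = b by apply: eb => a; rewrite inE => /eqP->.
move=> ga; rewrite inE => /predU1P[-> //|gas] r.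
rewrite -{1}eb -mulrA [e * _]mulrA cen -!mulrA [b * _]mulrA eb.
apply: (IH (fun al => e * c al)) => //.
  exact: path_sorted dec.
move=> r'; have -> : skew_poly s (fun al => e * c al) = f e * skew_poly (al :: s) c.
  rewrite skew_poly_scalel // /skew_poly big_cons.
  by rewrite -[c al]mul1r annL ?mem_head // rmorph0 mul0r add0r.
by rewrite [f r' * _]mulrA -rmorphM ann0.
Qed.

(** Once the leading coefficient vanishes, the tail is the same element and still satisfies [Q]. *)
Lemma decreasing_peel (Q : A -> Prop) s c : decreasing s ->
  (forall al h, al \in s -> low_weight f x w (wt al) h -> Q (f (c al) * X al + h) ->
    c al = 0) ->
  Q (skew_poly s c) -> skew_poly s c = 0.
Proof.
elim: s => [_ _ _|al s IH dec c_eq0 Qs]; first by rewrite /skew_poly big_nil.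
have cons : skew_poly (al :: s) c = f (c al) * X al + skew_poly s c.
  by rewrite /skew_poly big_cons.
have c0 : c al = 0.
  apply: c_eq0 (mem_head _ _) (decreasing_tail_low c dec) _.
  by rewrite -cons.
move: Qs; rewrite cons c0 rmorph0 mul0r add0r; apply: IH; first exact: path_sorted dec.
by move=> be h bes; apply: c_eq0; rewrite inE bes orbT.
Qed.

End Weighted.

(** * Property $(a.c.)$ of the extension *)

Lemma skew_poly_perm s t c : perm_eq s t -> skew_poly s c = skew_poly t c.
Proof. exact: perm_big. Qed.

(** One weight orders the generators and the annihilated element together, since their leading terms
    get multiplied. *)
Lemma separating_decreasing (k : nat) (s : 'I_k -> seq {ffun 'I_n -> nat}) s0 :
  (forall j, uniq (s j)) -> uniq s0 -> exists w t t0,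
  [/\ (forall i, 0 < w i)%N /\ (forall i j k, w k < w i + w j)%N,
      forall j, perm_eq (s j) (t j),
      forall j, sorted (fun al be => weight w be < weight w al)%N (t j),
      perm_eq s0 t0 & sorted (fun al be => weight w be < weight w al)%N t0].
Proof.
move=> us us0.
have [w [w_gt0 w_lt winj]] := separating_weight (s0 ++ flatten (map s (enum 'I_k))).
have [|t0 pt0 dec0] := @decreasing_perm w s0 us0.
  by apply: sub_in2 winj => al al0; rewrite mem_cat al0.
have /fin_all_exists2[t pt dect] j :
    exists2 t, perm_eq (s j) t & sorted (fun al be => weight w be < weight w al)%N t.
  apply: decreasing_perm => //; apply: sub_in2 winj => al al_j.
  rewrite mem_cat; apply/orP; right; apply/flattenP; exists (s j) => //.
  by rewrite map_f ?mem_enum.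
by exists w, t, t0.
Qed.

Lemma PBW_gen_family (k : nat) (g : 'I_k -> A) :
  exists (s : 'I_k -> seq _) (c : 'I_k -> _ -> R),
  forall j, uniq (s j) /\ g j = skew_poly (s j) (c j).
Proof.
have /fin_all_exists[s] := fun j => PBW_gen (g j).
by case/fin_all_exists=> c gE; exists s, c.
Qed.

Lemma pq_Baer_ac_right : right_pq_Baer R -> ac_right A.
Proof.
move=> pq k g; have [s [c gE]] := PBW_gen_family g.
have [e [ee cen annL annP]] :=
  right_pq_Baer_ann pq (flatten [seq map (c j) (s j) | j <- enum 'I_k]).
have inL j al : al \in s j -> c j al \in flatten [seq map (c j) (s j) | j <- enum 'I_k].
  move=> al_j; apply/flattenP; exists (map (c j) (s j)); last exact: map_f.
  by apply: map_f; rewrite mem_enum.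
have cenA a : a * f e = f e * (a * f e).
  have [t [d [_ ->]]] := PBW_gen a; rewrite skew_poly_scaler // skew_poly_scalel.
  by rewrite /skew_poly; apply: eq_bigr => al _; rewrite [in LHS]cen mulrA.
have gj0 j : g j * f e = 0.
  have [_ ->] := gE j; rewrite skew_poly_scaler // skew_poly_eq0 // => al /inL al_j.
  by rewrite -[c j al]mulr1 annL.
exists (f (1 - e)) => b; split=> [gb t|ann y [t ->]].
  have [s0 [c0 [us0 Db]]] := PBW_gen b.
  have gtb j a : g j * a * b = 0.
    apply: gb; exists (fun i => if i == j then a else 0).
    rewrite (bigD1 j) //= eqxx big1 ?addr0 // => i /negbTE ->.
    by rewrite mulr0.
  (* Then $(1-e)tb=(1-e)teb=(1-e)e\,teb=0$. *)
  suff Deb : f e * b = b.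
    rewrite -Deb mulrA -[_ * _ * f e]mulrA cenA mulrA -rmorphM.
    by rewrite mulrBl mul1r ee subrr rmorph0 !mul0r.
  apply/esym/eqP; rewrite -subr_eq0 -{1}[b]mul1r -(rmorph1 f) -mulrBl -rmorphB.
  have [w [t1 [t0 [[w_gt0 w_lt] pt dect pt0 dec0]]]] :=
    separating_decreasing (fun j => (gE j).1) us0.
  rewrite Db skew_poly_scalel (skew_poly_perm _ pt0).
  apply/eqP/(decreasing_peel (Q := fun h => forall j a, g j * a * h = 0) dec0).
    move=> al h _ lh Qh.
    have annb a : a \in flatten [seq map (c j) (s j) | j <- enum 'I_k] ->
        forall r, a * r * ((1 - e) * c0 al) = 0.
      case/flattenP=> _ /mapP[j _ ->] /mapP[be be_j ->].
      apply: (right_coef_ann w_gt0 w_lt pq (dect j) lh); last by rewrite -(perm_mem (pt j)).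
      by move=> r; rewrite mulrA -(skew_poly_perm _ (pt j)) -(gE j).2.
    (* The coefficient lies in $eR\cap(1-e)R=0$. *)
    by rewrite -(annP _ annb) mulrA mulrBr mulr1 ee subrr mul0r.
  move=> j a; rewrite -(skew_poly_perm _ pt0) -skew_poly_scalel -Db mulrA -[g j * a * _]mulrA.
  exact: gtb.
(* Taking $t=1$ gives $b=eb$, and then $g_jtb=g_jteb=(g_je)teb=0$. *)
have Db : b = f e * b.
  apply/eqP; rewrite -subr_eq0 -{1}[b]mul1r -(rmorph1 f) -mulrBl -rmorphB.
  by rewrite -[f _]mulr1 ann.
rewrite mulr_suml big1 // => j _.
by rewrite Db mulrA -[g j * _ * _]mulrA cenA mulrA gj0 !mul0r.
Qed.

Lemma pq_Baer_ac_left : left_pq_Baer R -> ac_left A.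
Proof.
move=> pq k g; have [s [c gE]] := PBW_gen_family g.
have [e [ee cen annL annP]] :=
  left_pq_Baer_ann pq (flatten [seq map (c j) (s j) | j <- enum 'I_k]).
have inL j al : al \in s j -> c j al \in flatten [seq map (c j) (s j) | j <- enum 'I_k].
  move=> al_j; apply/flattenP; exists (map (c j) (s j)); last exact: map_f.
  by apply: map_f; rewrite mem_enum.
have cenA a : f e * a = f e * a * f e.
  have [t [d [_ ->]]] := PBW_gen a; rewrite skew_poly_scalel skew_poly_scaler //.
  by rewrite /skew_poly; apply: eq_bigr => al _; rewrite [in LHS]cen mulrA.
have gj0 j : f e * g j = 0.
  have [_ ->] := gE j; rewrite skew_poly_scalel skew_poly_eq0 // => al /inL al_j.
  by rewrite -[c j al]mul1r annL.
exists (f (1 - e)) => b; split=> [gb t|ann y [t ->]].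
  have [s0 [c0 [us0 Db]]] := PBW_gen b.
  have gtb j a : b * (a * g j) = 0.
    apply: gb; exists (fun i => if i == j then a else 0).
    rewrite (bigD1 j) //= eqxx big1 ?addr0 // => i /negbTE ->.
    by rewrite mul0r.
  suff Deb : b * f e = b.
    rewrite -Deb -mulrA [f e * _]mulrA cenA -mulrA -rmorphM.
    by rewrite mulrBr mulr1 ee subrr rmorph0 !mulr0.
  apply/esym/eqP; rewrite -subr_eq0 -{1}[b]mulr1 -(rmorph1 f) -mulrBr -rmorphB.
  have [w [t1 [t0 [[w_gt0 w_lt] pt dect pt0 dec0]]]] :=
    separating_decreasing (fun j => (gE j).1) us0.
  (* Here [1 - e] multiplies from the right, and it acts on coefficients because idempotents of [R]
     commute with the monomials. *)
  have ee' : (1 - e) * (1 - e) = 1 - e by rewrite mulrBr mulr1 mulrBl mul1r ee subrr subr0.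
  rewrite Db skew_poly_scaler // (skew_poly_perm _ pt0).
  apply/eqP/(decreasing_peel (Q := fun h => forall j a, h * (a * g j) = 0) dec0).
    move=> al h _ lh Qh.
    have annb a : a \in flatten [seq map (c j) (s j) | j <- enum 'I_k] ->
        forall r, c0 al * (1 - e) * (r * a) = 0.
      case/flattenP=> _ /mapP[j _ ->] /mapP[be be_j ->].
      apply: (left_coef_ann w_gt0 w_lt pq (dect j) lh); last by rewrite -(perm_mem (pt j)).
      by move=> r; rewrite -(skew_poly_perm _ (pt j)) -(gE j).2.
    (* The coefficient lies in $Re\cap R(1-e)=0$. *)
    by rewrite -(annP _ annb) -mulrA mulrBl mul1r ee subrr mulr0.
  move=> j a; rewrite -(skew_poly_perm _ pt0) -skew_poly_scaler // -Db -mulrA mulrA.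
  by rewrite -mulrA [f _ * _]mulrA gtb.
have Db : b = b * f e.
  apply/eqP; rewrite -subr_eq0 -{1}[b]mulr1 -(rmorph1 f) -mulrBr -rmorphB.
  by rewrite -[f _]mul1r ann.
rewrite mulr_sumr big1 // => j _.
by rewrite Db -mulrA [f e * _]mulrA cenA -mulrA gj0 !mulr0.
Qed.

End Extension.

Theorem mainTheorem4 (R A : pzRingType) (f : {rmorphism R -> A}) (n : nat)
  (x : 'I_n -> A) (sigma delta : 'I_n -> R -> R) :
  bijective_skew_PBW f x sigma ->
  assoc_families f x sigma delta ->
  SD_compatible sigma delta ->
  (right_pq_Baer R -> ac_right A) /\ (left_pq_Baer R -> ac_left A).
Proof.
move=> PBW fam compat; split; first exact: pq_Baer_ac_right PBW fam compat.
exact: pq_Baer_ac_left PBW fam compat.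
Qed.
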